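(* Let $g:\mathbb{N}\to[1,\infty)$ and, for each perfect square $n\ge 4$, consider the $n$-node multi-hop mesh network in which $n-1$ sessions demand rate $\eta_n$ and the remaining session demands rate $\eta_n g(n)$. Let $T$ be the aggregate throughput of the 2-partitioning scheme whose first phase serves the $n-1$ low-rate sessions and whose second phase serves the single high-rate session. Then, as $n\to\infty$: (i) if $g(n)/\sqrt n\to0$, then $\mathbb{E}\{T\}=\Theta(\sqrt n)$; (ii) if $g(n)/\sqrt n\to\infty$ and $g(n)/n\to0$, then $\mathbb{E}\{T\}=\Theta\!\left(\dfrac{n}{g(n)}\right)$.
   Context: Network: $n$ nodes (with $n$ a perfect square) placed on a $\sqrt n\times\sqrt n$ two-dimensional mesh; two nodes are neighbors (joined by a wireless link) iff their coordinates agree in one dimension and differ by exactly $1$ in the other. There are $n$ unicast sessions: each node is the source of exactly one session and the destination of exactly one session, the source and destination of a session being distinct; the pairing is chosen uniformly at random among all such pairings. Multi-hopping scheme: each session is routed by X-Y routing: its packets first travel along dimension X, by the shortest path, until they reach the X-coordinate of the destination, then along dimension Y, by the shortest path, to the destination. Medium access is 9-TDMA spatial reuse: the mesh is divided into $3\times3$ blocks whose nodes are labeled $1,\dots,9$ in the same way in every block, and in time slot $t$ only nodes whose label is congruent to $t$ modulo $9$ transmit, each sending at most one packet to one neighbor; these transmissions are all successful (path loss exponent $\gamma>2$). Hence each node forwards at most one packet per $9$ slots. For a nonempty set $A$ of sessions, let $\rho_A$ be the largest common rate such that, when every session in $A$ (and no other session) sends at rate $\rho_A$, for every node $v$ the number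 of sessions in $A$ for which $v$ is a transmitting node of the route (any node on the route other than the destination), times $\rho_A$, is at most $1/9$. Put $T_A=|A|\rho_A$. 2-partitioning scheme: session $i$ has to transfer a data volume $W_i=c_0 r_i$ with $c_0>0$ a constant and $r_i$ its demand rate. The sessions are split into a low-rate set $A$ and a high-rate set $B$. In the first phase only the sessions of $A$ are served, all at common rate $\rho_A$, until all of them have finished (sessions that finish earlier send dummy packets), which takes time $t_1=\max_{i\in A}W_i/\rho_A$; then in the second phase only the sessions of $B$ are served, at common rate $\rho_B$, taking time $t_2=\max_{i\in B}W_i/\rho_B$. The aggregate throughput of the scheme is $T=\sum_i W_i/(t_1+t_2)$ (it does not depend on $c_0$ and $\eta_n$). $\mathbb{E}$ is the expectation over the random pairing. *)

(* Defs.v *)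
From HB Require Import structures.
From mathcomp Require Import all_boot all_order all_algebra all_fingroup zify.
From mathcomp Require Import all_classical all_reals all_analysis.

Set Implicit Arguments.
Unset Strict Implicit.
Unset Printing Implicit Defensive.

Import Order.TTheory GRing.Theory Num.Theory.
Import numFieldNormedType.Exports.

Local Open Scope classical_set_scope.
Local Open Scope ring_scope.

(* The m x m mesh, n = m ^ 2; a node is (X coordinate, Y coordinate). *)
Definition node (m : nat) : finType := ('I_m * 'I_m)%type.

Definition consecutive (m : nat) (i j : 'I_m) : bool :=
  (j == i.+1 :> nat) || (i == j.+1 :> nat).

Definition neighbor (m : nat) (u v : node m) : bool :=
  ((u.1 == v.1) && consecutive u.2 v.2) || ((u.2 == v.2) && consecutive u.1 v.1).

(* A session is named by its source: the session with source s has destination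
   p s. Fixed-point freeness says that source and destination differ. *)
Definition pairing (m : nat) : finType :=
  {p : {perm node m} | [forall s, p s != s]}.

Definition dest (m : nat) (p : pairing m) (s : node m) : node m := val p s.

Lemma card_pairing_gt0 (k : nat) : (0 < #|{: pairing k.+2}|)%N.
Proof.
have inj : injective (fun u : node k.+2 => (ordS u.1, u.2) : node k.+2).
  move=> [a b] [c e] /= E.
  by rewrite (ordS_inj (congr1 fst E)) (congr1 snd E : b = e).
have H : [forall s, perm inj s != s].
  apply/forallP => -[a b]; rewrite permE xpair_eqE negb_and.
  apply/orP; left; apply/eqP => /(congr1 val) /=.
  have := ltn_ord a; case: (ltngtP a.+1 k.+2) => // [lt _|[->]].
    by rewrite modn_small //; lia.
  by rewrite modnn.
by apply/card_gt0P; exists (exist _ (perm inj) H).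
Qed.

(* The coordinates visited when going from i to j by unit steps, in travel
   order, with the final j left out. *)
Definition steps (m : nat) (i j : 'I_m) : seq 'I_m :=
  if (i <= j)%N then [seq k : 'I_m <- enum 'I_m | (i <= k < j)%N]
  else rev [seq k : 'I_m <- enum 'I_m | (j < k <= i)%N].

(* X-Y routing from s to d, both included; xy_route_walk checks that this is a
   mesh path whose number of hops is the Manhattan distance. *)
Definition xy_route (m : nat) (s d : node m) : seq (node m) :=
  rcons ([seq (x, s.2) | x <- steps s.1 d.1] ++
         [seq (d.1, y) | y <- steps s.2 d.2]) d.

Lemma map_val_steps (m : nat) (i j : 'I_m) :
  map val (rcons (steps i j) j) =
  if (i <= j)%N then iota i (j - i).+1 else rev (iota j (i - j).+1).
Proof.
have filt (a b : nat) : (b <= m)%N ->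
    [seq val k | k : 'I_m <- enum 'I_m & (a <= k < b)%N] = iota a (b - a).
  move=> bm; rewrite -(filter_map val (fun k => (a <= k < b)%N)) val_enum_ord.
  apply: (irr_sorted_eq ltn_trans ltnn); last 1 first.
  - by move=> k; rewrite mem_filter !mem_iota; lia.
  - exact/(sorted_filter ltn_trans)/iota_ltn_sorted.
  - exact: iota_ltn_sorted.
rewrite map_rcons /steps; case: leqP => ij.
  by rewrite filt ?(ltnW (ltn_ord j)) // -addn1 iotaD /= cats1 subnKC.
by rewrite map_rev (filt j.+1 i.+1 (ltn_ord i)) subSS /= rev_cons.
Qed.

Lemma steps_walk (m : nat) (i j : 'I_m) :
  exists q, [/\ rcons (steps i j) j = i :: q, path (@consecutive m) i q
    & size q = ((i - j) + (j - i))%N].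
Proof.
have srt a k : sorted (fun x y : nat => y == x.+1) (iota a k).
  by case: k => //= k; elim: k a => //= k IH a; rewrite eqxx IH.
pose r (x y : nat) := (y == x.+1) || (x == y.+1).
have H : sorted r (map val (rcons (steps i j) j)).
  rewrite map_val_steps; case: ifP => _; rewrite ?rev_sorted.
    by apply: sub_sorted (srt _ _) => x y; rewrite /r => ->.
  by apply: sub_sorted (srt _ _) => x y; rewrite /r => ->; rewrite orbT.
have H2 : head 0%N (map val (rcons (steps i j) j)) = i.
  rewrite map_val_steps; case: leqP => // ij.
  by rewrite -addn1 iotaD rev_cat /= subnKC // ltnW.
have H3 : size (map val (rcons (steps i j) j)) = ((i - j) + (j - i)).+1.
  by rewrite map_val_steps; case: leqP => ij; rewrite ?size_rev size_iota; lia.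
case: (rcons _ _) H H2 H3 => // x q; rewrite size_map /= => H /val_inj xi [sz].
by exists q; rewrite xi in H *; split=> //; rewrite path_map in H.
Qed.

Lemma xy_route_walk (m : nat) (s d : node m) :
  exists q, [/\ xy_route s d = s :: q, path (@neighbor m) s q, last s q = d
    & size q = ((s.1 - d.1) + (d.1 - s.1) + ((s.2 - d.2) + (d.2 - s.2)))%N].
Proof.
have [q1 [E1 P1 S1]] := steps_walk s.1 d.1.
have [q2 [E2 P2 S2]] := steps_walk s.2 d.2.
pose fx (x : 'I_m) : node m := (x, s.2); pose fy (y : 'I_m) : node m := (d.1, y).
have Ey : rcons (map fy (steps s.2 d.2)) d = fy s.2 :: map fy q2.
  by rewrite -[in LHS](_ : fy d.2 = d) -?map_rcons ?E2 // /fy -surjective_pairing.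
have Er : xy_route s d = map fx (steps s.1 d.1) ++ fy s.2 :: map fy q2.
  by rewrite /xy_route rcons_cat Ey.
have srt : sorted (@neighbor m) (xy_route s d).
  rewrite Er sorted_cat_cons; apply/andP; split.
    rewrite -[fy s.2]/(fx d.1) -map_rcons E1 /= path_map.
    by apply: sub_path P1 => x y; rewrite /neighbor /= eqxx /= => ->; rewrite orbT.
  rewrite path_map; apply: sub_path P2 => x y; rewrite /neighbor /= eqxx /= => ->.
  by [].
have Hd : head d (xy_route s d) = s.
  rewrite Er -[fy s.2]/(fx d.1) -cat_rcons -map_rcons E1 /=.
  by rewrite /fx -surjective_pairing.
have Sz : size (xy_route s d) =
    ((s.1 - d.1) + (d.1 - s.1) + ((s.2 - d.2) + (d.2 - s.2))).+1.
  have := congr1 size E1; rewrite size_rcons /= S1 => -[e1].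
  by rewrite Er size_cat /= !size_map e1 S2 addnS.
have Ls : last d (xy_route s d) = d by rewrite /xy_route last_rcons.
case: (xy_route s d) srt Hd Sz Ls => // x q /= H xs [sz] Ls.
by exists q; rewrite xs in H Ls *.
Qed.

Definition transmits (m : nat) (p : pairing m) (v s : node m) : bool :=
  (v \in xy_route s (dest p s)) && (v != dest p s).

Definition load (m : nat) (p : pairing m) (A : {set node m}) (v : node m) : nat :=
  #|[set s in A | transmits p v s]|.

Section Throughput.
Variable R : realType.

(* 1 / 9 is the forwarding rate, in packets per slot, of a node under 9-TDMA. *)
Definition feasible_rate (m : nat) (p : pairing m) (A : {set node m}) (rho : R)
  : Prop :=
  0 <= rho /\ forall v : node m, (load p A v)%:R * rho <= 9^-1.

(* For A nonempty the supremum is attained: see max_rateP. *)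
Definition max_rate (m : nat) (p : pairing m) (A : {set node m}) : R :=
  sup [set rho | feasible_rate p A rho].

Lemma max_rateP (m : nat) (p : pairing m) (A : {set node m}) :
  A != finset.set0 ->
  feasible_rate p A (max_rate p A) /\
  forall rho, feasible_rate p A rho -> rho <= max_rate p A.
Proof.
move=> /set0Pn[s sA].
have ld : (0 < load p A s)%N.
  rewrite card_gt0; apply/set0Pn; exists s; rewrite inE sA /= /transmits.
  have [q [-> _ _ _]] := xy_route_walk s (dest p s).
  by rewrite mem_head /= eq_sym /dest (forallP (valP p)).
have E0 : [set rho | feasible_rate p A rho] 0.
  by split=> // v; rewrite mulr0 invr_ge0.
have ub : ubound [set rho | feasible_rate p A rho] 9^-1.
  move=> rho [rho0 /(_ s)]; apply: le_trans.
  by rewrite ler_peMl // ler1n.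
have E_ub rho : feasible_rate p A rho -> rho <= max_rate p A.
  by move=> Hr; apply: ub_le_sup => //; exists 9^-1.
split=> //; split=> [|v]; first exact: E_ub.
have [->|lv] := posnP (load p A v); first by rewrite mul0r invr_ge0.
rewrite mulrC -ler_pdivlMr ?ltr0n //; apply: ge_sup; first by exists 0.
by move=> rho [_ /(_ v)]; rewrite mulrC -ler_pdivlMr ?ltr0n.
Qed.

Definition volume (m : nat) (c0 : R) (r : node m -> R) (s : node m) : R :=
  c0 * r s.

(* Volumes are nonnegative in every use, so the default value 0 of the iterated
   maximum is harmless. *)
Definition phase_time (m : nat) (c0 : R) (r : node m -> R) (p : pairing m)
    (A : {set node m}) : R :=
  \big[Num.max/0]_(s in A) (volume c0 r s / max_rate p A).

Definition two_partition_throughput (m : nat) (c0 : R) (r : node m -> R)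
    (p : pairing m) (A B : {set node m}) : R :=
  (\sum_(s : node m) volume c0 r s) /
  (phase_time c0 r p A + phase_time c0 r p B).

(* Session h demands eta * gn, every other session demands eta. *)
Definition one_high_demand (m : nat) (eta gn : R) (h s : node m) : R :=
  if s == h then eta * gn else eta.

(* E{X}, the pairing being uniformly distributed. *)
Definition expect_pairing (m : nat) (X : pairing m -> R) : R :=
  (\sum_(p : pairing m) X p) / #|{: pairing m}|%:R.

End Throughput.

(* Main.v *)
Require Import Defs.
From HB Require Import structures.
From mathcomp Require Import all_boot all_order all_algebra all_fingroup.
From mathcomp Require Import all_classical all_reals all_analysis.
From mathcomp Require Import zify ring lra.

(* Writing rho for the common rate of the n - 1 low-rate sessions, the
   throughput is (n - 1 + g) / (1 / rho + 9 g). Since sources and destinations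
   are permutations of the nodes, a node forwards at most sqrt n sessions on
   their X leg and at most sqrt n on their Y leg, so 1 / rho <= 18 sqrt n: this
   gives the lower bounds, and (ii) altogether, for every pairing.
   For the upper bound in (i), the sessions going from the left half of the mesh
   to the right half must all cross one column of sqrt n nodes, so their number
   N satisfies (N - 1) rho <= sqrt n / 9, the 1 standing for the high-rate
   session, which may be among them. The uniform distribution on
   fixed-point-free permutations is invariant under conjugation, which
   determines E{N}, of order n, and bounds Var N by 4 n; by Chebyshev's
   argument E{rho} = O(1 / sqrt n). *)

Set Implicit Arguments.
Unset Strict Implicit.
Unset Printing Implicit Defensive.

Import Order.TTheory GRing.Theory Num.Theory.
Import numFieldNormedType.Exports.

(** * Fixed-point-free permutations under the counting measure *)

Section Derangements.
Variable T : finType.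

(** For [T := node m] this is convertible to [pairing m], so every count below applies to
    pairings. *)
Definition derangement : finType := {p : {perm T} | [forall s, p s != s]}.

Implicit Types (p : derangement) (s t a b : T).

Lemma conj_derangement_subproof (u : {perm T}) p :
  [forall s, (val p ^ u)%g s != s].
Proof.
apply/forallP => s; rewrite -(permKV u s) permJ (inj_eq perm_inj).
exact: (forallP (valP p)).
Qed.

Definition conj_derangement (u : {perm T}) p : derangement :=
  exist (fun q : {perm T} => [forall s, q s != s]) _
    (conj_derangement_subproof u p).

Lemma conj_derangement_inj u : injective (conj_derangement u).
Proof. by move=> p q /(congr1 val) /= /conjg_inj /val_inj. Qed.

(** Conjugation by [u] permutes the derangements, and [p ^ u] sends [u s] to [u (p s)]. *)
Lemma sum_pinned_conj (u : {perm T}) s t a b :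
  (\sum_(p : derangement) ((val p (u s) == u a) && (val p (u t) == u b)) =
  \sum_(p : derangement) ((val p s == a) && (val p t == b)))%N.
Proof.
rewrite (reindex_inj (@conj_derangement_inj u)); apply: eq_bigr => p _ /=.
by rewrite !permJ !(inj_eq perm_inj).
Qed.

Lemma sum_eq_image s p : (\sum_(a : T) (val p s == a) = 1)%N.
Proof.
rewrite (bigD1 (val p s)) //= eqxx big1 ?addn0 // => a /negPf.
by rewrite eq_sym => ->.
Qed.

(** By conjugation symmetry all [#|T| - 1] admissible images of [s] are taken equally often, and
    each derangement takes exactly one of them. *)
Lemma sum_pinned1 s a : a != s ->
  (#|T|.-1 * \sum_(p : derangement) (val p s == a) = #|derangement|)%N.
Proof.
move=> as_.
have -> : #|T|.-1 = #|[set~ s]| by rewrite cardsC1.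
rewrite -sum_nat_const.
rewrite (eq_bigr (fun b => \sum_(p : derangement) (val p s == b))%N).
  rewrite exchange_big /= -sum1_card; apply: eq_bigr => p _.
  rewrite -(sum_eq_image s p) [RHS](bigID (fun b => b \in [set~ s])) /=.
  rewrite [X in _ = (_ + X)%N]big1 ?addn0 // => b.
  rewrite !inE negbK => /eqP ->.
  by rewrite (negPf (forallP (valP p) s)).
move=> b; rewrite !inE => bs.
(* The transposition fixes [s]; repeating the same condition turns the two-point symmetry into a
   one-point one. *)
have := sum_pinned_conj (tperm a b) s s a a.
rewrite tpermL tpermD //.
by under eq_bigr do rewrite andbb; under [in RHS]eq_bigr do rewrite andbb.
Qed.

(** Conjugations fixing [s] and [t] carry [(a, b)] to each of the [(#|T| - 2) * (#|T| - 3)] ordered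
    pairs of distinct points outside [{s, t}]. These events are disjoint but need not be exhaustive,
    since [p s = t] or [p t = s] may occur; hence an inequality. *)
Lemma sum_pinned2 s t a b :
  s != t -> a != b -> a \notin [set s; t] -> b \notin [set s; t] ->
  ((#|T| - 2) * (#|T| - 3) *
     \sum_(p : derangement) ((val p s == a) && (val p t == b))
   <= #|derangement|)%N.
Proof.
move=> st ab; rewrite !inE !negb_or => /andP[as_ at_] /andP[bs bt].
have E a' b' : a' \in ~: [set s; t] -> b' \in ~: [set s; t; a'] ->
    (\sum_(p : derangement) ((val p s == a) && (val p t == b)) =
     \sum_(p : derangement) ((val p s == a') && (val p t == b')))%N.
  rewrite !inE !negb_or => /andP[as' at'] /andP[/andP[bs' bt'] ab'].
  (* The left factor acts first: it sends [a] to [a'] and [b] to [c]. The second then sends [c] to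
     [b'] and fixes [a'], which differs from both. *)
  pose c := tperm a a' b; pose u := (tperm a a' * tperm c b')%g.
  have cs x : x != a -> x != a' -> x != b -> x != b' -> u x = x.
    move=> xa xa' xb xb'; rewrite permM !tpermD // 1?eq_sym // /c.
    by case: tpermP.
  rewrite -(sum_pinned_conj u) (cs s) 1?(eq_sym s) // (cs t) 1?(eq_sym t) //.
  have -> : u a = a'.
    rewrite permM tpermL tpermD // /c -[X in _ != X](tpermL a a').
    by rewrite (inj_eq perm_inj) eq_sym.
  by rewrite [u b]permM tpermL.
set N := (\sum_(p : derangement) _)%N.
have <- : (\sum_(a' in ~: [set s; t]) \sum_(b' in ~: [set s; t; a']) N =
           (#|T| - 2) * (#|T| - 3) * N)%N.
  rewrite (eq_bigr (fun=> (#|T| - 3) * N)%N).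
    by rewrite sum_nat_const mulnA cardsCs finset.setCK cards2 st.
  move=> a'; rewrite !inE negb_or => /andP[as' at'].
  rewrite sum_nat_const cardsCs finset.setCK; congr ((_ - _) * _)%N.
  by rewrite finset.setUC cardsU1 !inE negb_or as' at' cards2 st.
rewrite (eq_bigr (fun a' => \sum_(b' in ~: [set s; t; a'])
    \sum_(p : derangement) ((val p s == a') && (val p t == b')))%N); last first.
  by move=> a' a'P; apply: eq_bigr => b' b'P; apply: E.
under eq_bigr do rewrite exchange_big.
rewrite exchange_big /= -sum1_card; apply: leq_sum => p _.
rewrite -(sum_eq_image s p) [leqRHS](bigID (fun b => b \in ~: [set s; t])) /=.
apply: leq_trans (leq_addr _ _); apply: leq_sum => a' _.
under eq_bigr do rewrite -mulnb.
rewrite -big_distrr /= -[leqRHS]muln1 leq_mul2l -(sum_eq_image t p).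
apply/orP; right.
by rewrite [leqRHS](bigID (fun b => b \in ~: [set s; t; a'])) /= leq_addr.
Qed.

Definition crossings (L R : {set T}) p : nat :=
  (\sum_(s in L) (val p s \in R))%N.

Lemma mem_sum_eq (R : {set T}) x :
  ((x \in R) = \sum_(a in R) (x == a) :> nat)%N.
Proof.
have [xR|xR] := boolP (x \in R).
  rewrite (bigD1 x) //= eqxx big1 ?addn0 // => a /andP[_ /negPf].
  by rewrite eq_sym => ->.
by rewrite big1 // => a aR; apply/eqP; rewrite eqb0; apply: contraNneq xR => ->.
Qed.

Variables L R : {set T}.
Hypothesis LR : [disjoint L & R].

Lemma sum_crossings :
  (#|T|.-1 * \sum_(p : derangement) crossings L R p =
   #|L| * #|R| * #|derangement|)%N.
Proof.
rewrite exchange_big /= big_distrr /= -mulnA -sum_nat_const.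
apply: eq_bigr => s sL.
under eq_bigr do rewrite mem_sum_eq.
rewrite exchange_big /= big_distrr /= -sum_nat_const; apply: eq_bigr => a aR.
by apply: sum_pinned1; apply: contraTneq aR => ->; rewrite (disjointFr LR).
Qed.

(** In the expanded square the terms [s = t] give back [crossings], and terms [s != t] with equal
    images vanish by injectivity. Disjointness of [L] and [R] makes [sum_pinned2] applicable to the
    others, of which there are at most [(#|L| * #|R|) ^ 2]. *)
Lemma sum_crossings_sqr :
  ((#|T| - 2) * (#|T| - 3) * \sum_(p : derangement) crossings L R p ^ 2 <=
   (#|T| - 2) * (#|T| - 3) * \sum_(p : derangement) crossings L R p +
   (#|L| * #|R|) ^ 2 * #|derangement|)%N.
Proof.
have E p : (crossings L R p ^ 2 = crossings L R p +
    \sum_(s in L) \sum_(t in L | t != s)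
      \sum_(a in R) \sum_(b in R | b != a)
        ((val p s == a) && (val p t == b)))%N.
  rewrite -mulnn [in LHS]/crossings big_distrlr /= -big_split /=.
  apply: eq_bigr => s sL; rewrite (bigD1 s) //= mulnb andbb; congr (_ + _)%N.
  apply: eq_bigr => t /andP[tL ts].
  rewrite [in LHS]mem_sum_eq [X in (_ * X)%N]mem_sum_eq big_distrlr /=.
  apply: eq_bigr => a aR; rewrite (bigD1 a) //=.
  rewrite mulnb [(_ && _)](_ : _ = false) ?add0n.
    by apply: eq_bigr => b _; rewrite mulnb.
  by apply/negP => /andP[/eqP <- /eqP /perm_inj E]; rewrite E eqxx in ts.
under eq_bigr do rewrite E.
rewrite big_split /= mulnDr leq_add2l expnMn.
rewrite -[(#|L| ^ 2)%N]mulnn -[(#|R| ^ 2)%N]mulnn.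
rewrite -!mulnA -sum_nat_const exchange_big /= mulnA big_distrr /=.
apply: leq_sum => s sL; rewrite exchange_big /= -sum_nat_const.
rewrite [leqRHS](bigID (fun t => t != s)) /= big_distrr /=.
apply: leq_trans (leq_addr _ _); apply: leq_sum => t /andP[tL ts].
rewrite exchange_big /= -sum_nat_const big_distrr /=; apply: leq_sum => a aR.
rewrite exchange_big /= -sum_nat_const.
rewrite [leqRHS](bigID (fun b => b != a)) /= big_distrr /=.
apply: leq_trans (leq_addr _ _); apply: leq_sum => b /andP[bR ba].
have out x : x \in R -> x \notin [set s; t].
  by move=> xR; apply: contraTN xR => /set2P[] ->; rewrite (disjointFr LR).
by apply: sum_pinned2; rewrite 1?eq_sym //; apply: out.
Qed.

End Derangements.

(** * Variance of the number of crossings *)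

Local Open Scope ring_scope.

(** Here [mu] is the mean of the count, [N] the number of derangements and [S2] the sum of squares.
    As [(n - 1)^2 - (n - 2)(n - 3) = 3n - 5], the variance is at most
    [mu + mu^2 (3n - 5) / ((n - 2)(n - 3))]. The bound [n^2 <= 3 (n - 2)(n - 3)] is an equality at
    [n = 6]. *)
Lemma variance_estimate (R : realFieldType) (n mu N S2 : R) :
  6 <= n -> 0 <= mu -> 4 * (mu * (n - 1)) <= n ^+ 2 -> 0 <= N ->
  (n - 2) * (n - 3) * S2 <=
    (n - 2) * (n - 3) * (mu * N) + (mu * (n - 1)) ^+ 2 * N ->
  S2 - mu ^+ 2 * N <= 4 * n * N.
Proof.
move=> n6 mu0 hq N0 h.
have D0 : 0 < (n - 2) * (n - 3) by apply: mulr_gt0; lra.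
have D3 : n ^+ 2 <= 3 * ((n - 2) * (n - 3)) by nra.
have mun : 3 * mu <= n.
  rewrite -(ler_pM2l (_ : 0 < n)); last by lra.
  by apply: le_trans (_ : 4 * (mu * (n - 1)) <= _); nra.
rewrite -(ler_pM2l D0) mulrBr lerBlDr; apply: le_trans h _.
rewrite -subr_ge0 [X in 0 <= X](_ : _ = N * (4 * n * ((n - 2) * (n - 3)) -
    (n - 2) * (n - 3) * mu - mu ^+ 2 * (3 * n - 5))); last by ring.
apply: mulr_ge0 => //.
have h1 : (n - 2) * (n - 3) * (3 * mu) <= (n - 2) * (n - 3) * n.
  by rewrite ler_pM2l.
have h2 : (3 * mu) ^+ 2 * (3 * n - 5) <= n ^+ 2 * (3 * n).
  apply: ler_pM; rewrite ?sqr_ge0 //; [lra| |lra].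
  by rewrite ler_sqr ?nnegrE //; lra.
have h3 : n ^+ 2 * n <= 3 * ((n - 2) * (n - 3)) * n by rewrite ler_pM2r //; lra.
rewrite exprMn in h2; move: D0 h1 h2 h3.
(* With the products as atoms the claim is linear: [3 H <= G], [9 E <= 3 F] and [F <= 3 G] give
   [H + E <= 4 G]. *)
set D := (n - 2) * (n - 3); set E := mu ^+ 2 * (3 * n - 5).
rewrite (_ : 3 ^+ 2 * mu ^+ 2 * (3 * n - 5) = 9 * E); last by rewrite /E; ring.
rewrite (_ : n ^+ 2 * (3 * n) = 3 * (n ^+ 2 * n)); last by ring.
rewrite -[4 * n * D]mulrA (mulrC n D) -[3 * D * n]mulrA.
rewrite (mulrCA D 3 mu); set F := n ^+ 2 * n; set G := D * n; set H := D * mu.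
move=> D0 h1 h2 h3.
have : 0 <= G by rewrite mulr_ge0 // ?ltW //; lra.
lra.
Qed.

Lemma crossings_variance (R : realFieldType) (T : finType) (A B : {set T}) :
  [disjoint A & B] -> (6 <= #|T|)%N ->
  \sum_(p : derangement T)
      ((crossings A B p)%:R - (#|A| * #|B|)%:R / #|T|.-1%:R) ^+ 2
    <= 4 * #|T|%:R * #|derangement T|%:R :> R.
Proof.
move=> AB n6.
have abn : (#|A| + #|B| <= #|T|)%N.
  rewrite -cardsUI; move: (AB); rewrite -setI_eq0 => /eqP ->.
  by rewrite cards0 addn0 max_card.
have abn2 : (4 * (#|A| * #|B|) <= #|T| ^ 2)%N.
  by apply: leq_trans (nat_AGM2 _ _) _; rewrite leq_exp2r.
have /(congr1 (fun k => k%:R : R)) := sum_crossings AB.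
have := sum_crossings_sqr AB; rewrite -(ler_nat R).
have n1 : #|T|.-1%:R = #|T|%:R - 1 :> R by rewrite -subn1 natrB //; lia.
have n10 : #|T|%:R - 1 != 0 :> R by rewrite -n1 pnatr_eq0; lia.
rewrite natrD (natrM _ (_ ^ 2)%N) natrX !natrM n1 !natrB //; try by lia.
rewrite !natr_sum (eq_bigr (fun p => (crossings A B p)%:R ^+ 2)); last first.
  by move=> p _; rewrite natrX.
set mu := _ / (_ - 1); set N := (#|derangement T|)%:R.
have -> : #|A|%:R * #|B|%:R * N = mu * (#|T|%:R - 1) * N.
  by rewrite /mu divfK.
rewrite (_ : #|A|%:R * #|B|%:R = mu * (#|T|%:R - 1)); last first.
  by rewrite /mu divfK.
move=> S2 S1.
rewrite (eq_bigr (fun p => (crossings A B p)%:R ^+ 2 -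
    (2 * mu) * (crossings A B p)%:R + mu ^+ 2)); last by move=> p _; ring.
rewrite big_split sumrB /= -mulr_sumr sumr_const -[_ *+ #|_|]mulr_natr.
have S1' : \sum_p (crossings A B p)%:R = mu * N.
  by apply: (mulfI n10); rewrite S1; ring.
rewrite S1' in S2 *.
set s2 := \sum_p _ in S2 *.
rewrite (_ : _ + _ = s2 - mu ^+ 2 * N); last by rewrite /N; ring.
apply: variance_estimate S2; rewrite ?ler_nat ?(ler_nat _ 6) //.
  by rewrite /mu divr_ge0 // -n1 ler0n.
by rewrite /mu divfK // -natrX -!natrM ler_nat.
Qed.

(** * Loads, rates and throughput on the mesh *)

Section Mesh.
Variable m : nat.
Implicit Types (p : pairing m) (v s d : node m) (A : {set node m}).

Lemma mem_xy_route s d v :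
  v \in xy_route s d -> (v.2 == s.2) || (v.1 == d.1).
Proof.
rewrite mem_rcons in_cons mem_cat => /predU1P[->|/orP[]/mapP[x _ ->]] /=;
  by rewrite eqxx ?orbT.
Qed.

Lemma load_le p A v : (load p A v <= m.*2)%N.
Proof.
apply: (@leq_trans #|[set s : node m | s.2 == v.2] :|:
                    (val p) @^-1: [set d : node m | d.1 == v.1]|).
  apply: subset_leq_card; apply/fintype.subsetP => s; rewrite !inE.
  by case/andP=> _ /andP[/mem_xy_route]; rewrite !(eq_sym v.1) !(eq_sym v.2).
apply: leq_trans (leq_card_setU _ _) _; rewrite -addnn.
rewrite card_preimset; last exact: perm_inj.
apply: leq_add.
  rewrite (_ : [set s | _] = finset.setX [set: 'I_m] [set v.2]).
    by rewrite cardsX cards1 muln1 finset.cardsT card_ord.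
  by apply/finset.setP => -[a b]; rewrite !inE.
rewrite (_ : [set s | _] = finset.setX [set v.1] [set: 'I_m]).
  by rewrite cardsX cards1 mul1n finset.cardsT card_ord.
by apply/finset.setP => -[a b]; rewrite !inE andbT.
Qed.

Definition left_part (h : nat) : {set node m} := [set s : node m | (s.1 < h)%N].

Lemma card_left_part h : (h <= m)%N -> #|left_part h| = (h * m)%N.
Proof.
move=> hm.
rewrite (_ : left_part h =
             finset.setX [set i : 'I_m | (i < h)%N] [set: 'I_m]).
  rewrite cardsX finset.cardsT card_ord; congr (_ * _)%N.
  rewrite -sum1_card (eq_bigl (fun i : 'I_m => (i < h)%N)) => [|i].
    by rewrite (big_ord_narrow hm) sum1_card card_ord.
  by rewrite inE.
by apply/finset.setP => -[a b]; rewrite !inE andbT.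
Qed.

(** The X leg stays at the source's Y coordinate and passes column [c]. The strict inequality
    matters, because [steps] omits its endpoint. *)
Lemma transmits_cut p s (c : 'I_m) :
  (s.1 <= c)%N -> (c < (dest p s).1)%N -> transmits p (c, s.2) s.
Proof.
move=> sc cd; apply/andP; split; last first.
  by apply/eqP => /(congr1 fst) /= E; rewrite -E ltnn in cd.
rewrite mem_rcons in_cons mem_cat; apply/or3P/Or32.
apply/mapP; exists c => //; rewrite /steps (leq_trans sc (ltnW cd)).
by rewrite mem_filter sc cd mem_enum.
Qed.

(** Each crossing session other than [x] is charged to the node of column [c] at its source's Y
    coordinate; the successor pays for [x]. *)
Lemma crossings_le_load p (x : node m) (c : 'I_m) :
  (crossings (left_part c.+1) (~: left_part c.+1) p <=
   (\sum_(y < m) load p (~: [set x]) (c, y)).+1)%N.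
Proof.
rewrite /crossings -[leqRHS]addn1.
rewrite (bigID (fun s => s != x)) /=; apply: leq_add; last first.
  apply: (@leq_trans (\sum_(s | s == x) 1)%N); last by rewrite big_pred1_eq.
  rewrite [leqLHS]big_mkcond [leqRHS]big_mkcond; apply: leq_sum => s _.
  by rewrite negbK andbC; case: (s == x) => /=; [case: ifP; rewrite ?leq_b1 | ].
under [leqRHS]eq_bigr => y _ do rewrite /load -sum1_card big_mkcond.
rewrite exchange_big /= [leqLHS]big_mkcond; apply: leq_sum => s _.
case: ifP => // /andP[sL sx]; rewrite (bigD1 s.2) //= !inE sx /=.
apply: leq_trans (leq_addr _ _); rewrite -leqNgt.
case: ltnP => //= cd; rewrite transmits_cut //.
by move: sL; rewrite inE.
Qed.

Variable R : realType.

(** The rate constraints of the [m] nodes of column [c] are added up. *)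
Lemma feasible_rate_cut p x (c : 'I_m) (rho : R) :
  feasible_rate p (~: [set x]) rho ->
  ((crossings (left_part c.+1) (~: left_part c.+1) p)%:R - 1) * rho <= m%:R / 9.
Proof.
move=> [rho0 Hrho].
apply: (@le_trans _ _ ((\sum_(y < m) load p (~: [set x]) (c, y))%N%:R * rho)).
  by apply: ler_wpM2r => //; rewrite lerBlDr natr1 ler_nat crossings_le_load.
rewrite natr_sum mulr_suml; apply: (@le_trans _ _ (\sum_(y < m) 9^-1)).
  exact: ler_sum.
by rewrite sumr_const card_ord mulr_natl.
Qed.

Lemma max_rate_ge p A : A != finset.set0 -> (18 * m%:R)^-1 <= max_rate R p A.
Proof.
move=> A0; apply: (max_rateP R p A0).2; split=> [|v].
  by rewrite invr_ge0 mulr_ge0.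
have m0 : (0 < m)%N := leq_ltn_trans (leq0n _) (ltn_ord v.1).
rewrite ler_pdivrMr ?mulr_gt0 ?ltr0n // (_ : 9^-1 * _ = m.*2%:R).
  by rewrite ler_nat load_le.
by rewrite -mul2n natrM; lra.
Qed.

(** The source of any session of [A] transmits it, so some load is at least 1. *)
Lemma max_rate_le p A : A != finset.set0 -> max_rate R p A <= 9^-1.
Proof.
move=> A0; have [[r0 Hr] _] := max_rateP R p A0.
have /set0Pn[s sA] := A0.
apply: le_trans (Hr s); rewrite ler_peMl // ler1n card_gt0.
apply/set0Pn; exists s; rewrite inE sA /= /transmits.
have [q [-> _ _ _]] := xy_route_walk s (dest p s).
by rewrite mem_head /= eq_sym /dest (forallP (valP p)).
Qed.

Lemma max_rate1 p x : max_rate R p [set x] = 9^-1.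
Proof.
have x0 : [set x] != finset.set0 by rewrite -card_gt0 cards1.
apply/eqP; rewrite eq_le max_rate_le //=.
apply: (max_rateP R p x0).2; split=> [|v]; first by rewrite invr_ge0.
rewrite ler_piMl ?invr_ge0 // lern1 -(cards1 x).
by apply: subset_leq_card; apply/fintype.subsetP => s; rewrite inE => /andP[].
Qed.

Lemma throughput_one_high p x (c0 eta gn : R) :
  (1 < m)%N -> 0 < c0 -> 0 < eta -> 0 <= gn ->
  two_partition_throughput c0 (one_high_demand eta gn x) p (~: [set x]) [set x]
  = ((m ^ 2)%:R - 1 + gn) / ((max_rate R p (~: [set x]))^-1 + 9 * gn).
Proof.
move=> m1 c00 eta0 gn0.
have A0 : ~: [set x] != finset.set0.
  rewrite -card_gt0 cardsC1 card_prod card_ord -subn1 subn_gt0; nia.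
have rho0 : 0 < max_rate R p (~: [set x]).
  apply: lt_le_trans (max_rate_ge p A0).
  by rewrite invr_gt0 mulr_gt0 // ltr0n; lia.
rewrite /two_partition_throughput /phase_time big_set1E max_rate1.
have -> : \sum_s volume c0 (one_high_demand eta gn x) s =
    c0 * eta * ((m ^ 2)%:R - 1 + gn).
  rewrite (bigD1 x) //= /volume /one_high_demand eqxx.
  rewrite (eq_bigr (fun=> c0 * eta)); last by move=> s /negPf ->.
  rewrite sumr_const cardC1 card_prod card_ord mulnn -[_ *+ _]mulr_natr.
  by rewrite -subn1 natrB; [ring | rewrite expn_gt0; lia].
have -> : \big[Num.max/0]_(s in ~: [set x])
    (volume c0 (one_high_demand eta gn x) s / max_rate R p (~: [set x])) =
    c0 * eta / max_rate R p (~: [set x]).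
  have E s : s \in ~: [set x] -> volume c0 (one_high_demand eta gn x) s /
      max_rate R p (~: [set x]) = c0 * eta / max_rate R p (~: [set x]).
    by rewrite !inE /volume /one_high_demand => /negPf ->.
  rewrite (eq_bigr _ E); have /set0Pn[s sA] := A0.
  apply/eqP; rewrite eq_le; apply/andP; split; last first.
    exact: (le_bigmax_cond _ (fun=> _) sA).
  by apply: bigmax_le => //; rewrite divr_ge0 ?mulr_ge0 ?ltW.
(* The maximum over a singleton still includes the default value 0, which a nonnegative volume
   absorbs. *)
rewrite /volume /one_high_demand eqxx max_l; last first.
  by rewrite !mulr_ge0 ?invr_ge0 // ltW.
rewrite invrK.
rewrite [X in _ / X](_ : _ =
    c0 * eta * ((max_rate R p (~: [set x]))^-1 + 9 * gn)).
  by rewrite -mulf_div divff ?mul1r // mulf_neq0 ?gt_eqF.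
by ring.
Qed.

End Mesh.

(** * Expected low-phase rate and bounds on the throughput *)

Section Expectation.
Variables (R : realType) (m : nat).
Implicit Types p : pairing m.

(** The removed session may vary with the pairing, since the random variable controlled,
    [crossings], does not involve it. *)
Lemma sum_max_rate_le (x : pairing m -> node m) : (4 < m)%N ->
  \sum_p max_rate R p (~: [set x p]) <= 67 / m%:R * #|{: pairing m}|%:R.
Proof.
move=> m4.
have m0 : 0 < m%:R :> R by rewrite ltr0n; lia.
(* The last column of the left half, so that [c.+1] is [m./2]. *)
have hm : (m./2.-1 < m)%N by lia.
pose c := Ordinal hm; pose L := left_part m c.+1.
have cardT : #|node m| = (m * m)%N by rewrite card_prod card_ord.
have cardL : #|L| = (m./2 * m)%N.
  by rewrite card_left_part //= ?prednK //; lia.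
have cardR : #|~: L| = ((m - m./2) * m)%N.
  by rewrite cardsCs finset.setCK cardL cardT mulnBl.
pose mu : R := (#|L| * #|~: L|)%:R / #|node m|.-1%:R.
have mu_ge : (m * m)%:R / 6 <= mu.
  rewrite ler_pdivlMr; last by rewrite ltr0n cardT; nia.
  rewrite mulrAC ler_pdivrMr ?ltr0n // -!natrM ler_nat cardT cardL cardR.
  have h3 : (m <= 3 * m./2)%N by lia.
  have h2 : (m <= 2 * (m - m./2))%N by lia.
  have h1 : (m * m <= 6 * (m./2 * (m - m./2)))%N.
    by apply: leq_trans (leq_mul h3 h2) _; lia.
  apply: (@leq_trans (m * m * (m * m))).
    by rewrite leq_mul2l leq_pred orbT.
  apply: (@leq_trans (6 * (m./2 * (m - m./2)) * (m * m))); last by lia.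
  by rewrite leq_mul2r h1 orbT.
(* Chebyshev in pointwise form: the first term bounds rho when X >= n / 12, the
   second one, using rho <= 1 / 9 and mu >= n / 6, when X < n / 12. *)
have pointwise p : max_rate R p (~: [set x p]) <=
    3 / m%:R + 16 / (m * m)%:R ^+ 2 * ((crossings L (~: L) p)%:R - mu) ^+ 2.
  have A0 : ~: [set x p] != finset.set0.
    by rewrite -card_gt0 cardsC1 cardT; nia.
  have [feas _] := max_rateP R p A0.
  have [rho0 _] := feas.
  have := feasible_rate_cut c feas.
  have := max_rate_le R p A0.
  rewrite -/L; set X := (crossings _ _ _)%:R; set rho := max_rate _ _ _.
  set n : R := (m * m)%:R => rho9 cut.
  have nE : n = m%:R * m%:R by rewrite /n natrM.
  have n0 : 0 < n by rewrite nE mulr_gt0.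
  have n24 : 24 <= n by rewrite (ler_nat _ 24); nia.
  have [Xn|Xn] := leP (n / 12) X.
    apply: le_trans (_ : 3 / m%:R <= _); last first.
      by rewrite lerDl mulr_ge0 ?sqr_ge0 // divr_ge0 // sqr_ge0.
    rewrite ler_pdivlMr // -(ler_pM2r m0).
    (* From [n >= 24], [X - 1 >= n / 24]; hence [rho <= 24 / (9 m) <= 3 / m]. *)
    have : n / 24 * rho <= m%:R / 9.
      by apply: le_trans cut; apply: ler_wpM2r => //; lra.
    rewrite -[rho * _ * _]mulrA -nE; lra.
  apply: le_trans rho9 _.
  apply: le_trans (_ : 16 / n ^+ 2 * (X - mu) ^+ 2 <= _); last first.
    by rewrite lerDr divr_ge0 // ltW.
  rewrite mulrAC ler_pdivlMr ?exprn_gt0 //.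
  (* Here [mu - X >= n / 6 - n / 12], and 16 is chosen so that [16 / n^2 * (n / 12)^2 = 1 / 9]. *)
  have : (n / 12) ^+ 2 <= (mu - X) ^+ 2.
    by rewrite ler_sqr ?nnegrE; move: mu_ge; rewrite -/n; lra.
  rewrite -[(mu - X) ^+ 2]sqrrN opprB expr_div_n; lra.
apply: le_trans (ler_sum _ (fun p _ => pointwise p)) _.
rewrite big_split /= sumr_const -mulr_sumr -[_ *+ #|_|]mulr_natr.
have LR : [disjoint L & ~: L] by rewrite -setI_eq0 finset.setICr.
have := @crossings_variance R _ L (~: L) LR; rewrite -/mu cardT.
move=> /(_ ltac:(nia)) var.
have q0 : 0 <= 16 / (m * m)%:R ^+ 2 :> R by rewrite divr_ge0 ?sqr_ge0.
apply: le_trans (lerD (lexx _) (ler_wpM2l q0 var)) _.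
rewrite !mulrA -mulrDl ler_wpM2r //.
rewrite (_ : 16 / _ * 4 * _ = 64 / m%:R / m%:R); last first.
  by rewrite natrM; field; rewrite gt_eqF.
rewrite -mulrDl ler_wpM2r ?invr_ge0 ?(ltW m0) //.
(* One factor [1 / m] is given up, and [3 + 64 = 67]. *)
have : 64 / m%:R <= 64 :> R by rewrite ler_pdivrMr // ler_peMr // ler1n; lia.
lra.
Qed.

Lemma expect_pairing_ge (X : pairing m -> R) (c : R) :
  (0 < #|{: pairing m}|)%N -> (forall p, c <= X p) -> c <= expect_pairing X.
Proof.
move=> N0 Xc.
rewrite /expect_pairing ler_pdivlMr ?ltr0n // mulr_natr -sumr_const.
exact: ler_sum.
Qed.

Lemma expect_pairing_le (X : pairing m -> R) (c : R) :
  (0 < #|{: pairing m}|)%N -> (forall p, X p <= c) -> expect_pairing X <= c.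
Proof.
move=> N0 Xc.
rewrite /expect_pairing ler_pdivrMr ?ltr0n // mulr_natr -sumr_const.
exact: ler_sum.
Qed.

End Expectation.

(** All three come from [(n - 1 + gn) / (1 / rho + 9 gn)]: the lower bound uses [gn >= 1] and
    [1 / rho <= 18 sqrt n]; each upper bound drops one summand of the denominator. *)
Lemma throughput_estimates (R : realType) (k : nat) (c0 eta gn : R)
    (p : pairing k.+2) (x : node k.+2) :
  0 < c0 -> 0 < eta -> 1 <= gn ->
  let T := two_partition_throughput c0 (one_high_demand eta gn x) p
    (~: [set x]) [set x] in
  let n : R := (k.+2 ^ 2)%:R in
  [/\ n / (18 * k.+2%:R + 9 * gn) <= T,
      T <= (n + gn) * max_rate R p (~: [set x]) &
      T <= (n + gn) / (9 * gn)].
Proof.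
move=> c00 eta0 gn1 T n.
have A0 : ~: [set x] != finset.set0.
  by rewrite -card_gt0 cardsC1 card_prod card_ord.
rewrite /T throughput_one_high ?(le_trans ler01) //.
have := max_rate_ge R p A0; set rho := max_rate _ _ _ => rho_ge.
have n1 : 1 <= n by rewrite ler1n expn_gt0.
have d0 : 0 < 18 * k.+2%:R :> R by rewrite mulr_gt0.
have rho0 : 0 < rho by apply: lt_le_trans rho_ge; rewrite invr_gt0.
have rV : rho^-1 <= 18 * k.+2%:R.
  by rewrite -[leRHS]invrK lef_pV2 // posrE ?invr_gt0.
have rV0 : 0 < rho^-1 by rewrite invr_gt0.
rewrite -/n; split.
- apply: ler_pM; [lra| |lra|].
    by rewrite invr_ge0; lra.
  by rewrite lef_pV2 ?posrE; lra.
- apply: ler_pM; [lra| |lra|].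
    by rewrite invr_ge0; lra.
  by rewrite -[leRHS]invrK lef_pV2 ?posrE; lra.
- apply: ler_pM; [lra| |lra|].
    by rewrite invr_ge0; lra.
  by rewrite lef_pV2 ?posrE; lra.
Qed.

(** * Asymptotics *)

Local Open Scope classical_set_scope.

Lemma eqTheta_near (R : realType) (f h : nat -> R) (a b : R) : 0 < a -> 0 < b ->
  (\forall k \near \oo, 0 <= h k /\ a * h k <= f k <= b * h k) ->
  f =Theta_\oo h.
Proof.
move=> a0 b0 H; rewrite eqThetaE; apply/asboolP.
exists (a, b) => /=; first by rewrite a0.
apply: filterS H => k [h0 /andP[h1 h2]] /=.
have f0 : 0 <= f k by apply: le_trans h1; rewrite mulr_ge0 // ltW.
by rewrite !ger0_norm // h1.
Qed.

(* The perfect squares n >= 4 are n = k.+2 ^ 2 for k : nat. The high-rate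
   session is arbitrary, and may depend on n and on the pairing. *)
Theorem theorem4 (R : realType) (c0 : R) (eta g : nat -> R)
    (high : forall k : nat, pairing k.+2 -> node k.+2)
    (c0_gt0 : 0 < c0) (eta_gt0 : forall n : nat, 0 < eta n)
    (g_ge1 : forall n : nat, 1 <= g n) :
  let n (k : nat) : nat := (k.+2 ^ 2)%N in
  let sqrt_n (k : nat) : R := Num.sqrt (n k)%:R in
  let T (k : nat) (p : pairing k.+2) : R :=
    two_partition_throughput c0
      (one_high_demand (eta (n k)) (g (n k)) (high k p)) p
      (~: [set high k p])%SET [set high k p]%SET in
  let ET (k : nat) : R := expect_pairing (T k) in
  (g (n k) / sqrt_n k @[k --> \oo] --> (0 : R) ->
     ET =Theta_\oo sqrt_n)
  /\
  (g (n k) / sqrt_n k @[k --> \oo] --> +oo ->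
   g (n k) / (n k)%:R @[k --> \oo] --> (0 : R) ->
     ET =Theta_\oo (fun k => (n k)%:R / g (n k))).
Proof.
move=> n sqrt_n T ET.
have sqrtE k : sqrt_n k = k.+2%:R.
  by rewrite /sqrt_n /n natrX sqrtr_sqr ger0_norm.
have nE k : (n k)%:R = k.+2%:R * k.+2%:R :> R by rewrite /n natrX.
have m0 k : 0 < k.+2%:R :> R by rewrite ltr0n.
have g1 k : 1 <= g (n k) := g_ge1 _.
have est k p := throughput_estimates p (high k p) c0_gt0 (eta_gt0 (n k)) (g1 k).
split=> [g_small|g_large g_lt_n].
  (* Once [g <= sqrt n], the denominator [18 sqrt n + 9 g] is at most [27 sqrt n], and
     [n + g <= 2 n] doubles the constant 67. *)
  apply: (@eqTheta_near _ _ _ (27^-1) 134); rewrite ?invr_gt0 //.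
  have gm : \forall k \near \oo, g (n k) / sqrt_n k < 1.
    exact: (cvgr_lt _ g_small _ ltr01).
  near=> k.
  have gk : g (n k) <= k.+2%:R.
    rewrite -[leRHS]mul1r -ler_pdivrMr // -sqrtE ltW //.
    by near: k.
  rewrite sqrtE; split; first exact: ltW.
  have N0 := card_pairing_gt0 k.
  apply/andP; split.
    apply: expect_pairing_ge => // p; have [+ _ _] := est k p; apply: le_trans.
    rewrite ler_pdivlMr; last first.
      by rewrite ltr_wpDl ?mulr_ge0 //; have := g1 k; lra.
    apply: le_trans (_ : 27^-1 * k.+2%:R * (27 * k.+2%:R) <= _).
      by rewrite ler_wpM2l ?mulr_ge0 ?invr_ge0 //; lra.
    by rewrite -/(n k) nE; lra.
  rewrite /ET /expect_pairing ler_pdivrMr ?ltr0n //.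
  have g0 : 0 <= (n k)%:R + g (n k).
    by have := g1 k; rewrite nE; have := m0 k; nra.
  apply: le_trans (_ : \sum_p ((n k)%:R + g (n k)) *
      max_rate R p (~: [set high k p])%SET <= _).
    by apply: ler_sum => p _; have [_ + _] := est k p.
  rewrite -mulr_sumr.
  have k4 : (4 < k.+2)%N by near: k; exists 3%N.
  apply: le_trans (ler_wpM2l g0 (sum_max_rate_le R (high k) k4)) _.
  rewrite mulrA ler_wpM2r // mulrA ler_pdivrMr //.
  have : k.+2%:R <= (n k)%:R :> R by rewrite ler_nat /n; nia.
  move: gk; rewrite -[_ * _ * k.+2%:R]mulrA -nE; lra.
(* Once [sqrt n <= g <= n], [18 sqrt n + 9 g <= 27 g] and [(n + g) / (9 g) <= n / g]. *)
apply: (@eqTheta_near _ _ _ (27^-1) 1); rewrite ?invr_gt0 //.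
have gm : \forall k \near \oo, 1 <= g (n k) / sqrt_n k.
  by move/cvgryPge : g_large; apply.
have gn : \forall k \near \oo, g (n k) / (n k)%:R < 1.
  exact: (cvgr_lt _ g_lt_n _ ltr01).
near=> k.
have gk : k.+2%:R <= g (n k).
  rewrite -[leLHS]mul1r -ler_pdivlMr // -sqrtE.
  by near: k.
have n0 : 0 < (n k)%:R :> R by rewrite nE mulr_gt0.
have gnk : g (n k) <= (n k)%:R.
  rewrite -[leRHS]mul1r -ler_pdivrMr // ltW //.
  by near: k.
have g0 : 0 < g (n k) := lt_le_trans ltr01 (g1 k).
have N0 := card_pairing_gt0 k.
split; first by rewrite divr_ge0 ?ltW.
apply/andP; split.
  apply: expect_pairing_ge => // p; have [+ _ _] := est k p; apply: le_trans.
  rewrite mulrCA -invfM ler_pM2l //.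
  by rewrite lef_pV2 ?posrE ?mulr_gt0 //; have := m0 k; lra.
apply: expect_pairing_le => // p; have [_ _ +] := est k p => /le_trans; apply.
rewrite mul1r ler_pdivrMr ?mulr_gt0 //.
rewrite -/(n k) (_ : _ / _ * _ = 9 * (n k)%:R); last by field; rewrite gt_eqF.
lra.
Unshelve. all: by end_near.
Qed.
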